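(* Let $\mu$ be a Borel probability measure on the unit circle $\mathbb{S}^1\subset\mathbb{R}^2$. Then $$\int_{\mathbb{S}^1}\int_{\mathbb{S}^1}\int_{\mathbb{S}^1}\left|\langle x,y\rangle\langle x,z\rangle\langle y,z\rangle\right|\,d\mu(x)\,d\mu(y)\,d\mu(z)\ge\frac14,$$ with equality if and only if $\mu$ is, up to central symmetry, a convex combination of uniform distributions over two (not necessarily distinct) orthonormal bases; that is, letting $\pi:\mathbb{S}^1\to\mathbb{S}^1/\{\pm1\}$ be the quotient map $x\mapsto[x]=\{x,-x\}$, equality holds if and only if there exist unit vectors $a,b\in\mathbb{S}^1$ and $\lambda\in[0,1]$ such that $$\pi_*\mu=\lambda\left(\tfrac12\delta_{[a]}+\tfrac12\delta_{[a^\perp]}\right)+(1-\lambda)\left(\tfrac12\delta_{[b]}+\tfrac12\delta_{[b^\perp]}\right),$$ where $v^\perp$ denotes a unit vector orthogonal to $v$.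
   Context: $\langle\cdot,\cdot\rangle$ is the Euclidean inner product on $\mathbb{R}^2$; $\pi_*\mu$ denotes the pushforward measure and $\delta$ a Dirac mass. *)

(* Defs.v *)
From HB Require Import structures.
From mathcomp Require Import all_boot all_order all_algebra.
From mathcomp Require Import all_classical all_reals all_analysis.
Set Implicit Arguments. Unset Strict Implicit. Unset Printing Implicit Defensive.
Import Order.TTheory GRing.Theory Num.Theory.
Local Open Scope ring_scope.
Local Open Scope classical_set_scope.

(* Points of R^2 are pairs (x.1, x.2) in R * R, whose canonical measurable
   structure is the product (= Borel) sigma-algebra. *)

Definition ip {R : realType} (x y : R * R) : R := x.1 * y.1 + x.2 * y.2.

Definition S1 {R : realType} : set (R * R) := [set x | ip x x = 1].

Definition oppv {R : realType} (x : R * R) : R * R := (- x.1, - x.2).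

Definition perp {R : realType} (x : R * R) : R * R := (- x.2, x.1).

(* centrally symmetric subsets of S^1: exactly the preimages pi^{-1}(B)
   of subsets B of S^1/{+-1} under the quotient map pi *)
Definition sym_sub_S1 {R : realType} (A : set (R * R)) : Prop :=
  A `<=` S1 /\ (forall x, A x -> A (oppv x)).

(* Main.v *)
(* Drop the absolute value: with M = \int z z^T dmu, a symmetric matrix of trace 1, the
   integral of <x,y><x,z><y,z> is tr M^3 >= 1/4, with equality iff M = I/2. Equality
   in the theorem thus means M = I/2 together with <x,y><x,z><y,z> >= 0 on the
   support K of mu.

   Fix a in K. If some point of K is orthogonal to a, any two points of K lying in
   opposite open quadrants of the frame (a, a^perp) must be orthogonal, so K lies on
   the lines of at most two frames. Otherwise the lines of K fill an angle at most
   pi/2, and if e spans the extreme line then z |-> <e,z><e^perp,z> has constant sign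
   on K; its integral is <e, M e^perp> = 0, so mu lives on the frame (e, e^perp).
   Finally M = I/2 forces the two lines of each frame to have the same mass. *)

Require Import Defs.
From HB Require Import structures.
From mathcomp Require Import all_boot all_order all_algebra.
From mathcomp Require Import all_classical all_reals all_analysis.
From mathcomp Require Import measurable_realfun ring lra.
Import Order.TTheory GRing.Theory Num.Theory.
Import numFieldNormedType.Exports.
Local Open Scope ring_scope.
Local Open Scope classical_set_scope.
Local Open Scope ereal_scope.

(** * The triple product and its measurability *)

Definition ip3 {R : realType} (x y z : R * R) : R :=
  (ip x y * ip x z * ip y z)%R.

Lemma measurable_ip {d} {X : measurableType d} {R : realType} (f g : X -> R * R) :
  measurable_fun setT f -> measurable_fun setT g ->
  measurable_fun setT (fun t => ip (f t) (g t)).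
Proof.
move=> mf mg; apply: measurable_funD; apply: measurable_funM.
- exact: (measurableT_comp measurable_fst mf).
- exact: (measurableT_comp measurable_fst mg).
- exact: (measurableT_comp measurable_snd mf).
- exact: (measurableT_comp measurable_snd mg).
Qed.

Lemma measurable_ip3 {d} {X : measurableType d} {R : realType}
    (f g h : X -> R * R) :
  measurable_fun setT f -> measurable_fun setT g -> measurable_fun setT h ->
  measurable_fun setT (fun t => ip3 (f t) (g t) (h t)).
Proof.
by move=> mf mg mh; do 2?apply: measurable_funM; exact: measurable_ip.
Qed.

Lemma measurable_S1 {R : realType} : measurable (S1 : set (R * R)).
Proof.
rewrite (_ : S1 = (fun x : R * R => ip x x) @^-1` [set 1%R]); last by [].
rewrite -[X in measurable X]setTI.
by apply: measurable_ip => //; exact: measurable_id.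
Qed.

Lemma ip_sqr_le1 {R : realType} (z : R * R) : S1 z ->
  [/\ (`|z.1 * z.1| <= 1)%R, (`|z.1 * z.2| <= 1)%R & (`|z.2 * z.2| <= 1)%R].
Proof.
case: z => a b; rewrite /S1 /ip /= => h.
by split; rewrite ler_norml; nra.
Qed.

(** * Second moments: the entries of M *)

Definition quad {R : realType} (a b c : R) (z : R * R) : R :=
  (a * (z.1 * z.1) + b * (z.1 * z.2) + c * (z.2 * z.2))%R.

(** The coefficient [b] of [quad] carries the whole cross term, so the arguments [1 0 0], [0 1 0]
    and [0 0 1] give exactly M11, M12 and M22. *)
Definition mom {R : realType} (mu : probability (R * R)%type R) (a b c : R) : R :=
  fine (\int[mu]_(z in S1) (quad a b c z)%:E).

Lemma measurable_quad {R : realType} (a b c : R) : measurable_fun setT (quad a b c).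
Proof.
by repeat apply: measurable_funD; repeat apply: measurable_funM => //;
  (exact: measurable_fst || exact: measurable_snd).
Qed.

Lemma integrable_S1 {R : realType} (mu : probability (R * R)%type R)
    (g : R * R -> R) :
  measurable_fun setT g -> (forall z, S1 z -> `|g z| <= 1)%R ->
  mu.-integrable S1 (EFin \o g).
Proof.
move=> mg g1; apply: (@le_integrable _ _ _ _ _ _ _ (cst 1)) => //.
- exact: measurable_S1.
- by apply/measurable_EFinP; exact: measurable_funS mg.
- by move=> z /g1 /=; rewrite normr1 lee_fin.
- exact: finite_measure_integrable_cst measurable_S1.
Qed.

Lemma mom_linear {R : realType} (mu : probability (R * R)%type R) (a b c : R) :
  mu.-integrable S1 (EFin \o quad a b c) /\
  mom mu a b c = (a * mom mu 1 0 0 + b * mom mu 0 1 0 + c * mom mu 0 0 1)%R.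
Proof.
have i1 : mu.-integrable S1 (EFin \o (fun z : R * R => z.1 * z.1)%R).
  apply: integrable_S1 => [|z /ip_sqr_le1[]//].
  by apply: measurable_funM; exact: measurable_fst.
have i2 : mu.-integrable S1 (EFin \o (fun z : R * R => z.1 * z.2)%R).
  apply: integrable_S1 => [|z /ip_sqr_le1[]//].
  by apply: measurable_funM; [exact: measurable_fst|exact: measurable_snd].
have i3 : mu.-integrable S1 (EFin \o (fun z : R * R => z.2 * z.2)%R).
  apply: integrable_S1 => [|z /ip_sqr_le1[]//].
  by apply: measurable_funM; exact: measurable_snd.
have mS := @measurable_S1 R.
(* General coefficients, because the identity is used four times: for [a b c] and for the three unit
   triples that define the entries of M. *)
have key a' b' c' : mu.-integrable S1 (EFin \o quad a' b' c') /\
    \int[mu]_(z in S1) (quad a' b' c' z)%:E =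
    a'%:E * \int[mu]_(z in S1) (z.1 * z.1)%:E +
    b'%:E * \int[mu]_(z in S1) (z.1 * z.2)%:E +
    c'%:E * \int[mu]_(z in S1) (z.2 * z.2)%:E.
  have j1 := integrableZl mS a' i1; have j2 := integrableZl mS b' i2.
  have j3 := integrableZl mS c' i3.
  have j12 := integrableD mS j1 j2.
  split; first exact: (integrableD mS j12 j3).
  rewrite -(integralZl mS i1) -(integralZl mS i2) -(integralZl mS i3).
  rewrite -(integralD mS j1 j2) -(integralD mS j12 j3).
  by apply: eq_integral => z _.
have [q1 q2] := key a b c; split=> //.
have f1 := integrable_fin_num mS i1.
have f2 := integrable_fin_num mS i2.
have f3 := integrable_fin_num mS i3.
rewrite /mom !(key _ _ _).2 !(mul0e, mul1e, add0e, adde0).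
by rewrite /= -(fineK f1) -(fineK f2) -(fineK f3).
Qed.

(** The trace of M is the integral of <z,z>, which is constantly 1 on the circle. *)
Lemma mom_unit {R : realType} (mu : probability (R * R)%type R) :
  mu S1 = 1 -> (mom mu 1 0 0 + mom mu 0 0 1 = 1)%R.
Proof.
move=> h; have := (mom_linear mu 1 0 1).2; rewrite !mul1r mul0r addr0 => <-.
rewrite /mom (eq_integral (cst 1)); last first.
  by move=> z /set_mem zS; rewrite /quad !mul1r mul0r addr0 [X in X%:E]zS.
have mS := @measurable_S1 R.
rewrite integral_cst// mul1e; exact: (congr1 fine h).
Qed.

(** * Lower bounds, one variable at a time *)

Lemma integral_lower {R : realType} (mu : probability (R * R)%type R)
    (a b c e : R) (B : set (R * R)) (F : R * R -> \bar R) :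
  (0 <= e)%R -> measurable B -> measurable_fun setT F ->
  (forall z, 0 <= F z) ->
  (forall z, S1 z -> (quad a b c z + e * \1_B z)%:E <= F z) ->
  (mom mu a b c + e * fine (mu (B `&` S1)))%:E <= \int[mu]_(z in S1) F z.
Proof.
move=> e0 mB mF F0 QF; have mS := @measurable_S1 R.
have [iQ _] := mom_linear mu a b c.
have iI : mu.-integrable S1 (EFin \o (\1_B : R * R -> R)).
  apply: integrable_S1; first exact: measurable_indic.
  by move=> z _; rewrite indicE; case: (_ \in _); rewrite ?normr1 ?normr0.
have iB : mu.-integrable S1 (EFin \o (fun z => e * \1_B z)%R).
  exact: (integrableZl mS e iI).
have iQB : mu.-integrable S1 (EFin \o (fun z => quad a b c z + e * \1_B z)%R).
  exact: (integrableD mS iQ iB).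
have -> : (mom mu a b c + e * fine (mu (B `&` S1)))%:E =
    \int[mu]_(z in S1) (quad a b c z + e * \1_B z)%:E.
  under eq_integral do rewrite EFinD.
  rewrite integralD //= EFinD; congr (_ + _).
    by rewrite /mom fineK//; exact: integrable_fin_num iQ.
  under eq_integral do rewrite EFinM.
  rewrite integralZl//= integral_indic// EFinM fineK//.
  by apply: fin_num_measure; exact: measurableI.
(* [F] is not assumed integrable, so the comparison goes through the positive part of the lower
   bound: it dominates in integral, and it stays below [F] because [F] is nonnegative. *)
rewrite integralE; apply: le_trans (_ : _ <= \int[mu]_(z in S1)
   ((fun z => (quad a b c z + e * \1_B z)%:E) ^\+ z)) _.
  rewrite leeBlDr ?leeDl//; first exact: integral_ge0.
  exact: (integrable_neg_fin_num mS iQB).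
apply: ge0_le_integral => //.
- apply: measurable_funepos; apply/measurable_EFinP.
  apply: measurable_funS (_ : measurable_fun setT _) => //.
  apply: measurable_funD; first exact: measurable_quad.
  by apply: measurable_funM => //; exact: measurable_indic.
- exact: measurable_funS mF.
- by move=> z /QF h; rewrite funeposE ge_max h F0.
Qed.

Lemma measurable_integral_S1 {d} {X : measurableType d} {R : realType}
    (mu : probability (R * R)%type R) (G : X -> R * R -> \bar R) :
  measurable_fun setT (fun p : X * (R * R) => G p.1 p.2) ->
  (forall x z, 0 <= G x z) ->
  measurable_fun setT (fun x => \int[mu]_(z in S1) G x z).
Proof.
(* Truncating [G] to 0 off the circle turns the integral into one over the whole plane, to which
   Tonelli's measurability statement applies. *)
move=> mG G0; pose H (p : X * (R * R)) := (G p.1 \_ S1) p.2.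
rewrite (_ : (fun _ => _) = fubini_F mu H); last first.
  by apply/funext => x; rewrite integral_mkcond.
apply: measurable_fun_fubini_tonelli_F.
  have -> : H = (fun p => G p.1 p.2) \_ (setT `*` S1).
    apply/funext => -[x z]; rewrite /H !patchE /=.
    by congr (if _ then _ else _); apply/idP/idP; rewrite !inE => // -[].
  apply/(measurable_restrictT _ _).1; last exact: measurable_funS mG.
  by apply: measurableX => //; exact: measurable_S1.
by move=> p; apply: erestrict_ge0.
Qed.

Definition abs_energy {R : realType} (mu : probability (R * R)%type R) : \bar R :=
  \int[mu]_(x in S1) \int[mu]_(y in S1) \int[mu]_(z in S1) (`|ip3 x y z|)%:E.

Lemma measurable_inner {R : realType} (mu : probability (R * R)%type R) :
  measurable_fun setT (fun p : (R * R) * (R * R) =>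
    \int[mu]_(z in S1) (`|ip3 p.1 p.2 z|)%:E).
Proof.
apply: measurable_integral_S1 => [|p z]; last by rewrite lee_fin.
apply/measurable_EFinP; apply: measurableT_comp => //; apply: measurable_ip3.
- exact: (measurableT_comp measurable_fst measurable_fst).
- exact: (measurableT_comp measurable_snd measurable_fst).
- exact: measurable_snd.
Qed.

(** The variables z, y, x are integrated out in this order. Each stage leaves a quadratic form in
    the next variable plus an indicator term, so [integral_lower] applies again. The polynomial in
    p, q, r is tr M^3; the term in [e] is the gain from a region where the product is negative. *)
Lemma abs_energy_lower {R : realType} (mu : probability (R * R)%type R)
    (e : R) (A B C : set (R * R)) (p := mom mu 1 0 0) (r := mom mu 0 1 0)
    (q := mom mu 0 0 1) :
  (0 <= e)%R -> measurable A -> measurable B -> measurable C ->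
  (forall x y z, S1 x -> S1 y -> S1 z ->
    ip3 x y z + e * (\1_A x * \1_B y * \1_C z) <= `|ip3 x y z|)%R ->
  (p ^+ 3 + q ^+ 3 + 3 * r ^+ 2 * (p + q) +
   e * (fine (mu (A `&` S1)) * fine (mu (B `&` S1)) * fine (mu (C `&` S1))))%:E
  <= abs_energy mu.
Proof.
move=> e0 mA mB mC key.
have I0 (D : set (R * R)) x : (0 <= \1_D x :> R)%R by rewrite indicE.
have m0 (D : set (R * R)) : (0 <= fine (mu D))%R by rewrite fine_ge0.
set a' := fine (mu (A `&` S1)); set b' := fine (mu (B `&` S1)).
set c' := fine (mu (C `&` S1)).
(* Without the gain, this is <x,y><x,My>. *)
have inner x y : S1 x -> S1 y ->
    (ip x y * (x.1 * y.1 * p + (x.1 * y.2 + x.2 * y.1) * r + x.2 * y.2 * q)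
      + e * (\1_A x * \1_B y) * c')%:E <= \int[mu]_(z in S1) (`|ip3 x y z|)%:E.
  move=> Sx Sy; set k := ip x y.
  have := @integral_lower _ mu (k * (x.1 * y.1)) (k * (x.1 * y.2 + x.2 * y.1))
    (k * (x.2 * y.2)) (e * (\1_A x * \1_B y)) C (fun z => (`|ip3 x y z|)%:E).
  rewrite (mom_linear mu _ _ _).2 -/p -/q -/r -/c' => h.
  apply: le_trans (h _ _ _ _ _) => //.
  - by rewrite lee_fin; lra.
  - by rewrite !mulr_ge0.
  - apply/measurable_EFinP; apply: measurableT_comp => //.
    by apply: measurable_ip3.
  - move=> z Sz; rewrite lee_fin; apply: le_trans (key x y z Sx Sy Sz).
    by rewrite /quad /ip3 /k /ip; lra.
(* Without the gain, this is <x,M^2 x>; below, [n1] and [n2] are the coordinates of M x. *)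
have middle x : S1 x ->
    (x.1 * x.1 * (p ^+ 2 + r ^+ 2) + x.1 * x.2 * (2 * r * (p + q)) +
     x.2 * x.2 * (q ^+ 2 + r ^+ 2) + e * \1_A x * c' * b')%:E <=
    \int[mu]_(y in S1) \int[mu]_(z in S1) (`|ip3 x y z|)%:E.
  move=> Sx; pose n1 := (x.1 * p + x.2 * r)%R; pose n2 := (x.1 * r + x.2 * q)%R.
  have := @integral_lower _ mu (x.1 * n1) (x.1 * n2 + x.2 * n1) (x.2 * n2)
    (e * \1_A x * c') B (fun y => \int[mu]_(z in S1) (`|ip3 x y z|)%:E).
  rewrite (mom_linear mu _ _ _).2 -/p -/q -/r -/b' => h.
  apply: le_trans (h _ _ _ _ _) => //.
  - by rewrite lee_fin /n1 /n2; lra.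
  - by rewrite !mulr_ge0//; exact: m0.
  - exact: (measurableT_comp (measurable_inner mu) (measurable_pair1 x)).
  - by move=> y; apply: integral_ge0 => z _; rewrite lee_fin.
  - move=> y Sy; apply: le_trans (inner x y Sx Sy); rewrite lee_fin.
    by rewrite /quad /n1 /n2 /ip; lra.
have := @integral_lower _ mu (p ^+ 2 + r ^+ 2) (2 * r * (p + q))
  (q ^+ 2 + r ^+ 2) (e * c' * b') A
  (fun x => \int[mu]_(y in S1) \int[mu]_(z in S1) (`|ip3 x y z|)%:E).
rewrite (mom_linear mu _ _ _).2 -/p -/q -/r -/a' => h.
apply: le_trans (h _ _ _ _ _) => //.
- by rewrite lee_fin; lra.
- by rewrite !mulr_ge0//; exact: m0.
- apply: measurable_integral_S1; first exact: measurable_inner.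
  by move=> x y; apply: integral_ge0 => z _; rewrite lee_fin.
- move=> x; apply: integral_ge0 => y _; apply: integral_ge0 => z _.
  by rewrite lee_fin.
- move=> x Sx; apply: le_trans (middle x Sx); rewrite lee_fin /quad.
  by lra.
Qed.

Lemma abs_energy_ge {R : realType} (mu : probability (R * R)%type R)
    (hS1 : mu S1 = 1) : (1 / 4)%:E <= abs_energy mu.
Proof.
have := @abs_energy_lower _ mu 0 setT setT setT (lexx _) measurableT measurableT
  measurableT.
rewrite mul0r addr0 => h; apply: le_trans (h _); last first.
  by move=> x y z _ _ _; rewrite mul0r addr0 ler_norm.
have := mom_unit mu hS1; set p := mom _ _ _ _; set q := mom _ _ _ _ => pq.
have -> : q = (1 - p)%R by lra.
set r := mom _ _ _ _; have h1 := sqr_ge0 (p - 2^-1); have h2 := sqr_ge0 r.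
by rewrite lee_fin; lra.
Qed.

(* With p, r, q the entries of M and p + q = 1, [abs_energy_lower] reads
   1/4 + 3 (p - 1/2)^2 + 3 r^2 + e mu(A) mu(B) mu(C) <= abs_energy mu. *)
Lemma abs_energy_eq {R : realType} (mu : probability (R * R)%type R)
    (hS1 : mu S1 = 1) : abs_energy mu = (1 / 4)%:E ->
  [/\ (mom mu 1 0 0 = 2^-1)%R, (mom mu 0 1 0 = 0)%R, (mom mu 0 0 1 = 2^-1)%R &
   forall (e : R) (A B C : set (R * R)), (0 < e)%R ->
     measurable A -> measurable B -> measurable C ->
     (forall x y z, A x -> B y -> C z -> ip3 x y z <= - e)%R ->
     ~ [/\ 0 < mu (A `&` S1), 0 < mu (B `&` S1) & 0 < mu (C `&` S1)]].
Proof.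
move=> E.
have low := @abs_energy_lower _ mu; rewrite E in low.
have pq := mom_unit mu hS1.
have := low 0%R setT setT setT (lexx _) measurableT measurableT measurableT.
rewrite mul0r addr0 lee_fin => /(_ _)/wrap[].
  by move=> x y z _ _ _; rewrite mul0r addr0 ler_norm.
move: low pq; set p := mom mu 1 0 0; set q := mom mu 0 0 1.
set r := mom mu 0 1 0 => low pq h1.
have qE : (q = 1 - p)%R by lra.
have h2 : (3 * (p - 2^-1) ^+ 2 + 3 * r ^+ 2 <= 0)%R by rewrite qE in h1; lra.
have h3 := sqr_ge0 (p - 2^-1); have h4 := sqr_ge0 r.
have r0 : r = 0%R by apply/eqP; rewrite -sqrf_eq0; apply/eqP; lra.
have pE : (p = 2^-1)%R.
  by apply/eqP; rewrite -subr_eq0 -sqrf_eq0; apply/eqP; lra.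
split=> //; first lra.
move=> e A B C e0 mA mB mC neg [A0 B0 C0].
have f0 (D : set (R * R)) : measurable D -> 0 < mu D -> (0 < fine (mu D))%R.
  move=> mD D0; rewrite fine_gt0// D0 /=.
  by apply: le_lt_trans (probability_le1 mu mD) (ltry _).
have mS := @measurable_S1 R.
have := low e A B C (ltW e0) mA mB mC; rewrite lee_fin => /(_ _)/wrap[].
  move=> x y z _ _ _; rewrite !indicE.
  have := ler_norm (ip3 x y z).
  case: (boolP (x \in A)) => [/set_mem Ax|_]; last by rewrite !mul0r mulr0 addr0.
  case: (boolP (y \in B)) => [/set_mem By|_]; last by rewrite mulr0 mul0r mulr0 addr0.
  case: (boolP (z \in C)) => [/set_mem Cz|_]; last by rewrite !mulr0 addr0.
  (* Where the product is at most [- e], its absolute value exceeds it by at least [2 * e], which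
     pays for the gain [e]. *)
  have h := neg x y z Ax By Cz.
  by move=> _; rewrite /= mulr1n ler0_norm; lra.
have a0 := f0 _ (measurableI _ _ mA mS) A0.
have b0 := f0 _ (measurableI _ _ mB mS) B0.
have c0 := f0 _ (measurableI _ _ mC mS) C0.
have := mulr_gt0 e0 (mulr_gt0 (mulr_gt0 a0 b0) c0).
by rewrite r0 qE pE; lra.
Qed.

(** * The support, and the sign of the triple product on it *)

Lemma cvg_ip {R : realType} {X : Type} (F : set_system X) {FF : Filter F}
    (f g : X -> R * R) (a b : R * R) :
  f x @[x --> F] --> a -> g x @[x --> F] --> b ->
  ip (f x) (g x) @[x --> F] --> ip a b.
Proof.
have fs (h : X -> R * R) (c : R * R) : h x @[x --> F] --> c ->
    (h x).1 @[x --> F] --> c.1 /\ (h x).2 @[x --> F] --> c.2.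
  case: c => c1 c2 hc; split.
    exact: (cvg_comp _ _ hc cvg_fst).
  exact: (cvg_comp _ _ hc cvg_snd).
by move=> /fs[f1 f2] /fs[g1 g2]; apply: cvgD; apply: cvgM.
Qed.

Lemma cvg_ip3 {R : realType} (x y z : R * R) :
  ip3 p.1.1 p.1.2 p.2 @[p --> ((x, y), z)] --> ip3 x y z.
Proof.
have f1 : p.1.1 @[p --> ((x, y), z)] --> x.
  by apply: (cvg_comp _ _ cvg_fst); exact: cvg_fst.
have f2 : p.1.2 @[p --> ((x, y), z)] --> y.
  by apply: (cvg_comp _ _ cvg_fst); exact: cvg_snd.
have f3 : p.2 @[p --> ((x, y), z)] --> z by exact: cvg_snd.
by apply: cvgM; [apply: cvgM|]; apply: cvg_ip.
Qed.

Definition rat_box {R : realType} (b : (rat * rat) * (rat * rat)) : set (R * R) :=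
  `]ratr b.1.1, ratr b.1.2[ `*` `]ratr b.2.1, ratr b.2.2[.

Lemma measurable_rat_box {R : realType} b : measurable (@rat_box R b).
Proof. by apply: measurableX; exact: measurable_itv. Qed.

Lemma nbhs_rat_itv {R : realType} (x : R) (P : set R) : nbhs x P ->
  exists a b : rat, `]ratr a, ratr b[ x /\ `]ratr a, ratr b[ `<=` P.
Proof.
move=> /nbhs_ballP[e /= e0 eP].
have [a] := @rat_in_itvoo R (x - e) x ltac:(lra).
have [b] := @rat_in_itvoo R x (x + e) ltac:(lra).
rewrite !in_itv /= => /andP[b1 b2] /andP[a1 a2].
exists a, b; split; first by rewrite /= in_itv /= a2 b1.
move=> y /=; rewrite in_itv /= => /andP[y1 y2]; apply: eP.
rewrite /ball /= ltr_norml; apply/andP; split; lra.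
Qed.

Lemma nbhs_rat_box {R : realType} (x : R * R) (U : set (R * R)) : nbhs x U ->
  exists b, rat_box b x /\ rat_box b `<=` U.
Proof.
case: x => x1 x2 [[P Q] [/= /(nbhs_rat_itv _ _)[a1 [b1 [ab1 ab1P]]]]].
move=> /(nbhs_rat_itv _ _)[a2 [b2 [ab2 ab2Q]]] PQU.
by exists ((a1, b1), (a2, b2)); split=> // -[y1 y2] [/ab1P ? /ab2Q ?]; apply: PQU.
Qed.

(* Only rational boxes are tested, so that the complement is a countable union. *)
Definition supp {R : realType} (mu : probability (R * R)%type R) : set (R * R) :=
  S1 `&` [set x | forall b, rat_box b x -> 0 < mu (rat_box b `&` S1)].

(** A point of the circle outside the support lies in a rational box whose trace on the circle is
    null, and there are only countably many such boxes. *)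
Lemma measure_S1_supp {R : realType} (mu : probability (R * R)%type R) :
  mu.-negligible (S1 `\` supp mu).
Proof.
pose N b : set (R * R) :=
  if mu (rat_box b `&` S1) == 0 then rat_box b `&` S1 else set0.
(* Enumeration of the boxes by their codes; a natural number that encodes no box yields the empty
   set. *)
pose M n : set (R * R) := if unpickle n is Some b then N b else set0.
suff : mu.-negligible (\bigcup_n M n).
  apply: negligibleS => x [Sx nx]; apply: contrapT => nb; apply: nx.
  split=> //= b bx; rewrite lt0e measure_ge0 andbT; apply/negP => mb; apply: nb.
  by exists (pickle b); [exact: I|rewrite /M pickleK /N mb; exact: (conj bx Sx)].
apply: negligible_bigcup => n; rewrite /M.
case: unpickle => [b|]; last exact: negligible_set0.
rewrite /N; case: ifPn => [/eqP h|_]; last exact: negligible_set0.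
exists (rat_box b `&` S1); split=> //; apply: measurableI.
  exact: measurable_rat_box.
exact: measurable_S1.
Qed.

Lemma supp_ip3_ge0 {R : realType} (mu : probability (R * R)%type R)
    (hS1 : mu S1 = 1) : abs_energy mu = (1 / 4)%:E ->
  forall x y z, supp mu x -> supp mu y -> supp mu z -> (0 <= ip3 x y z)%R.
Proof.
move=> /(abs_energy_eq mu hS1)[_ _ _ h] x y z [_ sx] [_ sy] [_ sz].
(* Half of the negative value is kept as a margin: by continuity the product stays below [- e] on a
   product of three boxes, each of positive mass, against [abs_energy_eq]. *)
rewrite leNgt; apply/negP => neg; pose e := (- (ip3 x y z / 2))%R.
have e0 : (0 < e)%R by rewrite /e; lra.
have lt : (ip3 x y z < - e)%R by rewrite /e; lra.
have [[P Q] [/= [[P1 P2] [/= nx ny] PP] nz] PQ] := cvgr_lt _ (cvg_ip3 x y z) _ lt.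
have [bx [bxx bxP]] := nbhs_rat_box _ _ nx.
have [by_ [byy byP]] := nbhs_rat_box _ _ ny.
have [bz [bzz bzP]] := nbhs_rat_box _ _ nz.
apply: (h e (rat_box bx) (rat_box by_) (rat_box bz)) => //.
- exact: measurable_rat_box.
- exact: measurable_rat_box.
- exact: measurable_rat_box.
- move=> u v w /bxP Pu /byP Pv /bzP Qw; apply/ltW.
  by apply: (PQ ((u, v), w)); split=> //=; exact: (PP (u, v)).
- by split; [exact: sx|exact: sy|exact: sz].
Qed.

(** * Integration of even functions against four symmetric atoms *)

(* The image of mu on S1/{+-1} is the sum of the w_i times the Dirac masses at [v_i]. *)
Definition atoms_sym {R : realType} (mu : probability (R * R)%type R)
    (w1 w2 w3 w4 : R) (v1 v2 v3 v4 : R * R) :=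
  [/\ (0 <= w1)%R, (0 <= w2)%R, (0 <= w3)%R & (0 <= w4)%R] /\
  [/\ S1 v1, S1 v2, S1 v3 & S1 v4] /\
  forall A : set (R * R), measurable A -> sym_sub_S1 A ->
    mu A = w1%:E * \d_v1 A + w2%:E * \d_v2 A + w3%:E * \d_v3 A + w4%:E * \d_v4 A.

(** [atoms_sym] determines mu only on symmetric sets. Preimages under the even function [h], cut
    down to the circle, are symmetric, so the pushforward of mu by [h] is a sum of four weighted
    Dirac masses on the real line. *)
Lemma integral_even {R : realType} (mu : probability (R * R)%type R)
    (hS1 : mu S1 = 1) (w1 w2 w3 w4 : R) (v1 v2 v3 v4 : R * R) (h : R * R -> R) :
  atoms_sym mu w1 w2 w3 w4 v1 v2 v3 v4 ->
  measurable_fun setT h -> (forall z, 0 <= h z)%R ->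
  (forall z, h (oppv z) = h z) ->
  \int[mu]_(z in S1) (h z)%:E =
    (w1 * h v1 + w2 * h v2 + w3 * h v3 + w4 * h v4)%:E.
Proof.
move=> [[w10 w20 w30 w40] [[S1v1 S1v2 S1v3 S1v4] muA]] mh h0 heven.
have mS := @measurable_S1 R.
have muC : mu (~` S1) = 0 by rewrite probability_setC// [X in 1 - X]hS1 subee.
(* The absolute value agrees with the identity on the values of [h] and is nonnegative on all of R,
   as the integral lemmas for nonnegative functions require. *)
pose f (y : R) : \bar R := (`|y|)%:E.
have mf : measurable_fun setT f by apply/measurable_EFinP; exact: normr_measurable.
have f0 y : setT y -> 0 <= f y by move=> _; rewrite lee_fin.
have -> : \int[mu]_(z in S1) (h z)%:E = \int[pushforward mu h]_y f y.
  rewrite ge0_integral_pushforward//; last by move=> y _; exact: f0.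
  rewrite preimage_setT [RHS](@ge0_negligible_integral _ _ _ _ _ (~` S1))//.
  - rewrite setDE setCK setTI; apply: eq_integral => z _.
    by rewrite /f /= ger0_norm.
  - exact: measurableC.
  - exact: measurableT_comp.
  - by move=> z _; exact: f0.
pose d w (w0 : (0 <= w)%R) v : {measure set R -> \bar R} :=
  mscale (NngNum w0) (dirac (h v)).
pose m2 : {measure set R -> \bar R} :=
  measure_add (measure_add (measure_add (d w1 w10 v1) (d w2 w20 v2))
    (d w3 w30 v3)) (d w4 w40 v4).
have m2E B : m2 B = d w1 w10 v1 B + d w2 w20 v2 B + d w3 w30 v3 B + d w4 w40 v4 B.
  etransitivity; first exact: measure_addE.
  congr (_ + _); etransitivity; first exact: measure_addE.
  by congr (_ + _); exact: measure_addE.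
rewrite (@eq_measure_integral _ _ _ _ m2) => [|B mB _]; last first.
  have mhB : measurable (h @^-1` B).
    by rewrite -[X in measurable X]setTI; exact: mh.
  rewrite m2E /d /= /mscale /= /pushforward.
  have -> : mu (h @^-1` B) = mu (h @^-1` B `&` S1).
    rewrite [LHS](measureDI mu mhB mS) setDE.
    rewrite (@subset_measure0 _ _ _ mu _ (~` S1)) ?add0e//.
    - by apply: measurableI => //; exact: measurableC.
    - exact: measurableC.
  rewrite muA; [|exact: measurableI|]; last first.
    split=> [z []//|z [Bz Sz]]; split; first by rewrite /= heven.
    by move: Sz; rewrite /S1 /ip /oppv /= !mulrNN.
  have dE v : S1 v -> \d_v (h @^-1` B `&` S1) = \d_(h v) B :> \bar R.
    by move=> Sv; rewrite !diracE; congr ((nat_of_bool _)%:R%:E); apply/idP/idP;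
      rewrite !inE // => -[].
  by rewrite !dE.
have dI w w0 v : \int[d w w0 v]_y f y = (w * h v)%:E.
  rewrite ge0_integral_mscale// integral_dirac// diracT mul1e.
  by rewrite /f ger0_norm.
by rewrite !ge0_integral_measure_add// !dI.
Qed.

(** * Frames and lines in the plane *)

(** Parseval's identity for [a] and [perp a], in a form homogeneous in [a]. *)
Lemma ip_frame {R : realType} (a x y : R * R) :
  (ip a x * ip a y + ip (perp a) x * ip (perp a) y = ip a a * ip x y)%R.
Proof. by rewrite /ip /perp /=; ring. Qed.

Lemma ipC {R : realType} (x y : R * R) : ip x y = ip y x.
Proof. by rewrite /ip; ring. Qed.

Lemma S1_perp {R : realType} (a : R * R) : S1 a -> S1 (perp a).
Proof. by rewrite /S1 /ip /perp /= => <-; ring. Qed.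

Lemma ip_perp {R : realType} (a : R * R) : ip a (perp a) = 0%R.
Proof. by rewrite /ip /perp /=; ring. Qed.

Lemma ip_perpl {R : realType} (a : R * R) : ip (perp a) a = 0%R.
Proof. by rewrite ipC ip_perp. Qed.

Lemma ip_oppr {R : realType} (a z : R * R) : ip a (oppv z) = (- ip a z)%R.
Proof. by rewrite /ip /oppv /=; ring. Qed.

Definition line {R : realType} (v : R * R) : set (R * R) := [set v; oppv v].

Lemma line_of_perp {R : realType} (e z : R * R) :
  S1 e -> S1 z -> ip (perp e) z = 0%R -> line e z.
Proof.
move=> Se Sz h.
(* [h1] and [h2] are the coordinates of the expansion of [z] in the frame of [e], whose component
   along [perp e] vanishes. *)
have h1 : (z.1 = ip e z * e.1)%R.
  transitivity (ip e z * e.1 - e.2 * ip (perp e) z)%R; last first.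
    by rewrite h mulr0 subr0.
  by rewrite -[LHS]mul1r -[in LHS]Se /ip /perp /=; ring.
have h2 : (z.2 = ip e z * e.2)%R.
  transitivity (ip e z * e.2 + e.1 * ip (perp e) z)%R; last first.
    by rewrite h mulr0 addr0.
  by rewrite -[LHS]mul1r -[in LHS]Se /ip /perp /=; ring.
have : (ip e z ^+ 2 = 1)%R.
  have := ip_frame e z z; rewrite h mulr0 addr0 -expr2 => ->.
  by rewrite [ip e e]Se [ip z z]Sz mulr1.
have zE : z = (ip e z * e.1, ip e z * e.2)%R.
  by rewrite -h1 -h2 -surjective_pairing.
move/eqP; rewrite sqrf_eq1 => /orP[]/eqP k; rewrite k ?mul1r ?mulN1r in zE.
  by left; rewrite zE -surjective_pairing.
by right; rewrite zE.
Qed.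

Lemma line_of_orth {R : realType} (e z : R * R) :
  S1 e -> S1 z -> ip e z = 0%R -> line (perp e) z.
Proof.
move=> Se Sz h; apply: line_of_perp => //; first exact: S1_perp.
by rewrite -[RHS]oppr0 -h /ip /perp /=; ring.
Qed.

(** * Two frames attain equality *)

(** Two of the three vectors belong to the same frame. If they are orthogonal the product is 0; if
    they are equal it is <u,u><u,v>^2. *)
Lemma ip3_frames_ge0 {R : realType} (a b x y z : R * R) :
  S1 a -> S1 b ->
  let P v := [\/ v = a, v = perp a, v = b | v = perp b] in
  P x -> P y -> P z -> (0 <= ip3 x y z)%R.
Proof.
move=> Sa Sb P.
have i0 v : (0 <= ip v v :> R)%R by rewrite /ip addr_ge0// -expr2 sqr_ge0.
have e1 u v : (0 <= ip3 u u v :> R)%R.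
  by rewrite /ip3 -mulrA mulr_ge0// -expr2 sqr_ge0.
have e2 u v : (0 <= ip3 u v u :> R)%R.
  by rewrite (_ : ip3 u v u = ip3 u u v)// /ip3 /ip; ring.
have e3 u v : (0 <= ip3 u v v :> R)%R.
  by rewrite (_ : ip3 u v v = ip3 v v u)// /ip3 /ip; ring.
by case=> -> [] -> [] ->; rewrite ?(e1, e2, e3)//;
  rewrite /ip3 ?ip_perp ?ip_perpl ?(mul0r, mulr0).
Qed.

Lemma atoms_sym_energy {R : realType} (mu : probability (R * R)%type R)
    (hS1 : mu S1 = 1) (a b : R * R) (w u : R) :
  (w + u = 2^-1)%R -> atoms_sym mu w w u u a (perp a) b (perp b) ->
  abs_energy mu = (1 / 4)%:E.
Proof.
move=> wu H; have [_ [[Sa _ Sb _] _]] := H.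
have [[w0 _ u0 _] _] := H.
(* [W] is integration against the four atoms. It replaces the integrals from the inside out; each
   integrand is even because the absolute value absorbs signs. *)
pose W (h : R * R -> R) :=
  (w * h a + w * h (perp a) + u * h b + u * h (perp b))%R.
pose P v := [\/ v = a, v = perp a, v = b | v = perp b].
have WE h h' : (forall v, P v -> h v = h' v) -> W h = W h'.
  move=> hh; rewrite /W !hh //; rewrite /P.
  - exact: Or44. - exact: Or43. - exact: Or42. - exact: Or41.
have W0 (h : R * R -> R) : (forall v, 0 <= h v)%R -> (0 <= W h)%R.
  by move=> h0; rewrite /W !addr_ge0// mulr_ge0.
have mW d (X : measurableType d) (h : X -> R * R -> R) :
    (forall v, measurable_fun setT (h ^~ v)) -> measurable_fun setT (fun x => W (h x)).
  by move=> mh; repeat apply: measurable_funD; apply: measurable_funM.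
have IE (h : R * R -> R) : measurable_fun setT h -> (forall z, 0 <= h z)%R ->
    (forall z, h (oppv z) = h z) -> \int[mu]_(z in S1) (h z)%:E = (W h)%:E.
  exact: integral_even.
have m3 (f g h : R * R -> R * R) : measurable_fun setT f ->
    measurable_fun setT g -> measurable_fun setT h ->
    measurable_fun setT (fun t => `|ip3 (f t) (g t) (h t)|%R).
  by move=> mf mg mh; apply: measurableT_comp => //; exact: measurable_ip3.
have oppE (x z : R * R) : ip (oppv x) z = (- ip x z)%R by rewrite ipC ip_oppr ipC.
transitivity (\int[mu]_(x in S1) \int[mu]_(y in S1) (W (fun z => `|ip3 x y z|%R))%:E).
  apply: eq_integral => x _; apply: eq_integral => y _; apply: IE => //.
    by apply: m3.
  by move=> z; rewrite /ip3 !ip_oppr; congr (`| _ |)%R; ring.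
transitivity (\int[mu]_(x in S1) (W (fun y => W (fun z => `|ip3 x y z|%R)))%:E).
  apply: eq_integral => x _; apply: IE.
  - by apply: mW => v; apply: m3.
  - by move=> y; apply: W0.
  - move=> y; apply: (WE) => v _; rewrite /ip3 ip_oppr oppE.
    by congr (`| _ |)%R; ring.
rewrite IE; first last.
- move=> x; apply: (WE) => v _; apply: (WE) => v' _; rewrite /ip3 !oppE.
  by congr (`| _ |)%R; ring.
- by move=> x; do 2 apply: (W0) => ?.
- by apply: (mW) => v; apply: (mW) => v'; apply: m3.
congr EFin.
transitivity (W (fun x => W (fun y => W (fun z => ip3 x y z)))).
  apply: (WE) => x Px; apply: (WE) => y Py; apply: (WE) => z Pz.
  by rewrite ger0_norm//; exact: (@ip3_frames_ge0 _ a b).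
(* This is M = I/2: by [ip_frame] each frame contributes its weight times <x,y>, and the weights add
   up to 1/2. *)
have frame x y : (W (fun z => ip x z * ip y z) = ip x y / 2)%R.
  have ha := ip_frame a x y; have hb := ip_frame b x y.
  rewrite Sa Sb !mul1r in ha hb.
  rewrite /W !(ipC x) !(ipC y) -wu.
  by rewrite -addrA -!mulrDr ha hb; ring.
have frame3 x y : W (fun z => ip3 x y z) = (ip x y * ip x y / 2)%R.
  by rewrite -mulrA -frame /W /ip3; ring.
under eq_fun do under eq_fun do rewrite frame3.
have frame2 x : W (fun y => ip x y * ip x y / 2)%R = (ip x x / 4)%R.
  transitivity (W (fun y => ip x y * ip x y) / 2)%R; first by rewrite /W; ring.
  by rewrite frame; field.
under eq_fun do rewrite frame2.
have Ea : ip a a = 1%R := Sa; have Eb : ip b b = 1%R := Sb.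
have Ea' : ip (perp a) (perp a) = 1%R := S1_perp _ Sa.
have Eb' : ip (perp b) (perp b) = 1%R := S1_perp _ Sb.
by rewrite /W Ea Eb Ea' Eb'; lra.
Qed.

(** * Planar geometry of the support *)

Lemma orth_frame_of_ip3_ge0 {R : realType} (K : set (R * R)) :
  K `<=` S1 -> K !=set0 ->
  (forall x y z, K x -> K y -> K z -> (0 <= ip3 x y z)%R) ->
  (exists e, S1 e /\ forall z, K z -> (ip e z * ip (perp e) z <= 0)%R) \/
  (exists a b, [/\ S1 a, S1 b, (ip a b * ip (perp a) b != 0)%R &
    K `<=` line a `|` line (perp a) `|` line b `|` line (perp b)]).
Proof.
move=> KS [a Ka] K0; have Sa := KS _ Ka.
pose c z := ip a z; pose s z := ip (perp a) z.
have ipE y z : ip y z = (c y * c z + s y * s z)%R.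
  by rewrite /c /s ip_frame [ip a a]Sa mul1r.
have cs1 z : K z -> (c z * c z + s z * s z = 1)%R by move=> /KS; rewrite -ipE.
have acute y z : K y -> K z -> (0 <= c y * c z * ip y z)%R.
  by move=> Ky Kz; exact: K0 Ka Ky Kz.
have [pos|] := pselect (forall z, K z -> (0 <= c z * s z)%R).
  (* Turning the frame by a right angle reverses the sign of the product, as [perp (perp a)] is the
     opposite of [a]. *)
  left; exists (perp a); split=> [|z Kz]; first exact: S1_perp.
  have -> : ip (perp (perp a)) z = (- c z)%R by rewrite /c /ip /perp /=; ring.
  by rewrite -/(s z); have := pos z Kz; lra.
move=> /existsNP[n /not_implyP[Kn /negP]]; rewrite -ltNge => csn.
have [[d Kd d0]|Kc] := pselect (exists2 d, K d & c d = 0%R).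
  have [neg|] := pselect (forall z, K z -> (c z * s z <= 0)%R).
    by left; exists a.
  move=> /existsNP[b /not_implyP[Kb /negP]]; rewrite -ltNge => csb.
  have Sb := KS _ Kb.
  (* Here [s d] is 1 or -1, so the triples (a,y,z) and (d,y,z) make <y,z> times [c y * c z] and
     <y,z> times [s y * s z] both nonnegative. Multiplying, <y,z>^2 has a negative factor and must
     vanish. *)
  have orth y z : K y -> K z -> (0 < c y * s y)%R -> (c z * s z < 0)%R ->
      ip y z = 0%R.
    move=> Ky Kz csy csz; have h1 := acute y z Ky Kz.
    have h2 : (0 <= s y * s z * ip y z)%R.
      have := K0 _ _ _ Kd Ky Kz; rewrite /ip3 (ipE d y) (ipE d z).
      have := cs1 d Kd; rewrite d0 !mul0r !add0r => sd.
      by rewrite mulrACA sd mul1r.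
    have h3 : (c y * c z * (s y * s z) < 0)%R.
      by rewrite mulrACA; have := mulr_gt0 csy (_ : 0 < - (c z * s z))%R;
        rewrite oppr_gt0 => /(_ csz); lra.
    have h4 := mulr_ge0 h1 h2.
    apply/eqP; rewrite -sqrf_eq0; apply/eqP.
    have := sqr_ge0 (ip y z); nra.
  have ln z : K z -> (c z * s z < 0)%R -> line (perp b) z.
    by move=> Kz csz; apply: line_of_orth (KS _ Kz) _ => //; exact: orth.
  right; exists a, b; split=> //; first by rewrite gt_eqF.
  move=> z Kz; have Sz := KS _ Kz.
  (* Negative points are orthogonal to [b]; positive ones are orthogonal to [n], which spans the
     line of [perp b]; the others lie on the frame of [a]. *)
  have [csz|csz|/eqP] := ltgtP (c z * s z)%R 0%R.
  - by right; exact: ln.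
  - left; right; apply: line_of_perp => //.
    have := orth z n Kz Kn csz csn; rewrite ipC.
    have [->//|->] := ln n Kn csn.
    by rewrite ipC ip_oppr ipC => /eqP; rewrite oppr_eq0 => /eqP.
  - rewrite mulf_eq0 => /orP[]/eqP h; left; left.
      by right; exact: line_of_orth.
    by left; exact: line_of_perp.
have c0 z : K z -> c z != 0%R by move=> Kz; apply/eqP => h; apply: Kc; exists z.
(* Slopes of the lines of K relative to [a]. By [acute], any two slopes satisfy 1 + t t' >= 0: the
   angle between the lines, measured through [a], is at most pi/2. A negative slope t' then bounds
   [T] above by -1/t'. *)
pose T := [set (s z / c z)%R | z in K].
have T1 y z : K y -> K z -> (- 1 <= (s y / c y) * (s z / c z))%R.
  move=> Ky Kz; have := acute y z Ky Kz; rewrite ipE.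
  have cc : (0 < (c y * c z) ^+ 2)%R by rewrite exprn_even_gt0 //= mulf_neq0 ?c0.
  rewrite (_ : _ * _ = (c y * c z) ^+ 2 * (1 + s y / c y * (s z / c z)))%R.
    by rewrite pmulr_rge0//; lra.
  by field; rewrite !c0.
have tn : (s n / c n < 0)%R.
  rewrite (_ : s n / c n = c n * s n / (c n ^+ 2))%R; last by field; rewrite c0.
  by rewrite ltr_pdivrMr ?mul0r// exprn_even_gt0 //= c0.
have Tub t' : (t' < 0)%R -> (forall t, T t -> - 1 <= t * t')%R ->
    ubound T (- t'^-1)%R.
  move=> t'0 ht t /ht h.
  by rewrite -invrN -[leRHS]mul1r ler_pdivlMr ?oppr_gt0// mulrN; lra.
have supT : has_sup T.
  split; first by exists (s a / c a)%R, a.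
  exists (- (s n / c n)^-1)%R; apply: Tub => // _ [z Kz <-]; exact: T1.
(* The slope of the extreme line. It need not be attained in K; [ge_al] carries the bound 1 + t t'
   >= 0 over to it. *)
pose al := sup T.
have le_al z : K z -> (s z / c z <= al)%R.
  by move=> Kz; apply: sup_upper_bound => //; exists z.
have al0 : (0 <= al)%R.
  apply: le_trans (le_al a Ka); rewrite /s /c ip_perpl mul0r//.
have ge_al z : K z -> (0 <= 1 + al * (s z / c z))%R.
  move=> Kz; have [h|h] := leP 0%R (s z / c z)%R.
    by rewrite addr_ge0// mulr_ge0.
  have : (al <= - (s z / c z)^-1)%R.
    apply: ge_sup; first by case: supT.
    by apply: Tub => // _ [y Ky <-]; exact: T1.
  by rewrite -invrN -[leRHS]mul1r ler_pdivlMr ?oppr_gt0// mulrN; lra.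
pose N := Num.sqrt (1 + al ^+ 2).
have N2 : (N ^+ 2 = 1 + al ^+ 2)%R by rewrite sqr_sqrtr// addr_ge0// sqr_ge0.
have N0 : N != 0%R by rewrite sqrtr_eq0 -ltNge ltr_pwDl// sqr_ge0.
(* This is [a] plus [al] times [perp a], normalised. With t the slope of z, the product to be signed
   is (c/N)^2 (1 + al t)(t - al). *)
left; exists ((a.1 - al * a.2) / N, (a.2 + al * a.1) / N)%R; split.
  rewrite /S1 /ip /=.
  transitivity ((1 + al ^+ 2) * ip a a / N ^+ 2)%R; first by rewrite /ip; field.
  by rewrite [ip a a]Sa N2 mulr1 divff// -N2 expf_neq0.
move=> z Kz.
rewrite (_ : _ * _ = (c z / N) ^+ 2 *
    ((1 + al * (s z / c z)) * (s z / c z - al)))%R; last first.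
  have : (c z != 0)%R := c0 z Kz.
  by move=> h; transitivity ((c z + al * s z) / N * ((s z - al * c z) / N))%R;
    [rewrite /c /s /ip /perp /=; field|field; rewrite N0 h].
apply: mulr_ge0_le0; first exact: sqr_ge0.
by apply: mulr_ge0_le0; [exact: ge_al|rewrite subr_le0 le_al].
Qed.

(** * From equality to two frames with balanced masses *)

Lemma integral_ip2 {R : realType} (mu : probability (R * R)%type R)
    (hS1 : mu S1 = 1) (u v : R * R) : abs_energy mu = (1 / 4)%:E ->
  \int[mu]_(z in S1) (ip u z * ip v z)%:E = (ip u v / 2)%:E.
Proof.
move=> /(abs_energy_eq mu hS1)[p r q _].
pose a := (u.1 * v.1)%R; pose b := (u.1 * v.2 + u.2 * v.1)%R.
pose c := (u.2 * v.2)%R; have [i mE] := mom_linear mu a b c.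
transitivity (\int[mu]_(z in S1) (quad a b c z)%:E).
  by apply: eq_integral => z _; congr EFin; rewrite /quad /ip /a /b /c; ring.
rewrite -[LHS]fineK; last by exact: (integrable_fin_num measurable_S1 i).
by rewrite -/(mom mu a b c) mE p r q; congr EFin; rewrite /ip /a /b /c; lra.
Qed.

Lemma negligible_off_frame {R : realType} (mu : probability (R * R)%type R)
    (hS1 : mu S1 = 1) (e : R * R) : abs_energy mu = (1 / 4)%:E -> S1 e ->
  (forall z, supp mu z -> (ip e z * ip (perp e) z <= 0)%R) ->
  mu.-negligible (S1 `\` (line e `|` line (perp e))).
Proof.
move=> E Se h; have mS := @measurable_S1 R.
pose g (z : R * R) : \bar R := (ip e z * ip (perp e) z)%:E.
have mip (u : R * R) : measurable_fun setT (ip u) by apply: measurable_ip.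
have mg : measurable_fun S1 g.
  apply/measurable_EFinP; apply: measurable_funS (_ : measurable_fun setT _) => //.
  by apply: measurable_funM.
(* On the support |g| = - g. The sign is moved onto [e], so that [integral_ip2] evaluates the
   integral as half of <-e, e^perp>, which is 0. *)
have ig : \int[mu]_(z in S1) `|g z| = 0.
  transitivity (\int[mu]_(z in S1) (ip (oppv e) z * ip (perp e) z)%:E).
    apply: ae_eq_integral => //.
    - exact: measurableT_comp.
    - apply/measurable_EFinP; apply: measurable_funS (_ : measurable_fun setT _) => //.
      by apply: measurable_funM.
    - apply: negligibleS (measure_S1_supp mu) => z /= nz.
      split; first by apply: contrapT => nS; apply: nz => /nS.
      move=> /h hz; apply: nz => _; rewrite /g /= ler0_norm// -mulNr.
      by congr (_ * _)%:E; rewrite /ip /oppv /=; ring.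
  rewrite integral_ip2// [ip _ _](_ : _ = 0)%R ?mul0r//.
  by rewrite /ip /oppv /perp /=; ring.
have /(ae_eq_integral_abs mu mS mg) := ig; apply: negligibleS => z [Sz nz] /=.
move=> /(_ Sz)[]/eqP; rewrite mulf_eq0 => /orP[]/eqP h0; apply: nz.
  by right; exact: line_of_orth.
by left; exact: line_of_perp.
Qed.

Lemma measurable_line {R : realType} (v : R * R) : measurable (line v).
Proof.
have m1 (u : R * R) : measurable [set u].
  rewrite (_ : [set u] = [set u.1] `*` [set u.2]); first exact: measurableX.
  by apply/seteqP; split=> [z ->//|[z1 z2] [/= -> ->]]; case: u.
by apply: measurableU; exact: m1.
Qed.

(** The functional <u,.> separates the lines: it vanishes on the first and nowhere on the second. *)
Lemma line_disjoint {R : realType} (u v w : R * R) :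
  ip u v = 0%R -> ip u w != 0%R -> line v `&` line w = set0.
Proof.
move=> uv uw; apply/seteqP; split=> // z [zv zw].
have h : ip u z = 0%R by case: zv => -> //; rewrite ip_oppr uv oppr0.
by case: zw h => -> => [|/eqP]; [exact/eqP|rewrite ip_oppr oppr_eq0 (negbTE uw)].
Qed.

(** A symmetric set contains both points of a line or neither, so it captures all of the mass of
    each [D] or none. Asking only for inclusion in a line lets some [D] be empty, which covers the
    case of a single frame. *)
Lemma atoms_sym_of_cover {R : realType} (mu : probability (R * R)%type R)
    (v1 v2 v3 v4 : R * R) (D1 D2 D3 D4 : set (R * R)) :
  [/\ S1 v1, S1 v2, S1 v3 & S1 v4] ->
  [/\ measurable D1, measurable D2, measurable D3 & measurable D4] ->
  [/\ D1 `<=` line v1, D2 `<=` line v2, D3 `<=` line v3 & D4 `<=` line v4] ->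
  [/\ D1 `&` D2 = set0, (D1 `|` D2) `&` D3 = set0 &
     (D1 `|` D2 `|` D3) `&` D4 = set0] ->
  mu.-negligible (S1 `\` (D1 `|` D2 `|` D3 `|` D4)) ->
  atoms_sym mu (fine (mu D1)) (fine (mu D2)) (fine (mu D3)) (fine (mu D4))
    v1 v2 v3 v4.
Proof.
move=> Sv [m1 m2 m3 m4] [l1 l2 l3 l4] [d2 d3 d4] neg.
split; first by split; exact: fine_ge0.
split=> // A mA [AS Aopp]; set U := _ `|` D4 in neg.
have mU : measurable U by do 3?apply: measurableU.
have oppK (z : R * R) : oppv (oppv z) = z.
  by case: z => z1 z2; rewrite /oppv /= !opprK.
have atom v D : measurable D -> D `<=` line v ->
    mu (A `&` D) = (fine (mu D))%:E * \d_v A.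
  move=> mD Dv; rewrite diracE; have [Av|nAv] := pselect (A v).
    rewrite mem_set// mule1 fineK ?fin_num_measure//; congr (mu _).
    apply: setIidr => z /Dv [->//|->]; exact: Aopp.
  rewrite memNset// mule0 (_ : A `&` D = set0) ?measure0//.
  apply/seteqP; split=> // z [Az /Dv[zv|zv]]; apply: nAv; first by rewrite -zv.
  by rewrite -(oppK v) -zv; exact: Aopp.
have I0 X Y : X `&` Y = set0 -> (A `&` X) `&` (A `&` Y) = set0.
  by move=> XY; rewrite setIACA XY setI0.
rewrite [LHS](measureDI mu mA mU).
rewrite (measure_negligible (measurableD mA mU)) ?add0e; last first.
  by apply: negligibleS neg => z [/AS].
rewrite /U !setIUr.
rewrite !measureU; try by repeat apply: measurableU; exact: measurableI.
all: first [by rewrite -?setIUr; exact: I0|by rewrite -!atom].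
Qed.

Lemma frames_of_abs_energy {R : realType} (mu : probability (R * R)%type R)
    (hS1 : mu S1 = 1) : abs_energy mu = (1 / 4)%:E ->
  exists (a b : R * R) (w u : R), (w + u = 2^-1)%R /\
    atoms_sym mu w w u u a (perp a) b (perp b).
Proof.
move=> E.
(* M = I/2 tested on z |-> <v,z>^2; taking v in the frames gives linear equations for the masses. *)
have mass w1 w2 w3 w4 v1 v2 v3 v4 v : atoms_sym mu w1 w2 w3 w4 v1 v2 v3 v4 ->
    (w1 * ip v v1 ^+ 2 + w2 * ip v v2 ^+ 2 + w3 * ip v v3 ^+ 2 +
     w4 * ip v v4 ^+ 2 = ip v v / 2)%R.
  move=> H; apply: EFin_inj; rewrite -(integral_ip2 mu hS1 v v E).
  rewrite -(integral_even mu hS1 _ _ _ _ _ _ _ _ (fun z => ip v z ^+ 2)%R H).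
  - by apply: eq_integral => z _; rewrite expr2.
  - by apply: measurable_funX; apply: measurable_ip.
  - by move=> z; exact: sqr_ge0.
  - by move=> z; rewrite ip_oppr sqrrN.
have supp0 : supp mu !=set0.
  apply/set0P/eqP => s0; have := measure_S1_supp mu.
  rewrite s0 setD0 => /(measure_negligible measurable_S1) h.
  by have := hS1; rewrite [LHS]h => /eqP; rewrite eqe eq_sym oner_eq0.
have suppS : supp mu `<=` S1 by move=> x [].
have [[e [Se he]]|[a [b [Sa Sb ab cover]]]] :=
    orth_frame_of_ip3_ge0 _ suppS supp0 (supp_ip3_ge0 mu hS1 E).
  have Ee : ip e e = 1%R := Se; have Ep : ip (perp e) (perp e) = 1%R := S1_perp _ Se.
  have d12 : line e `&` line (perp e) = set0.
    by rewrite setIC; apply: (line_disjoint e); rewrite ?ip_perp ?Ee ?oner_neq0.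
  have H := @atoms_sym_of_cover _ mu e (perp e) e (perp e) (line e)
    (line (perp e)) set0 set0.
  rewrite !setU0 !setI0 measure0 in H.
  have {}H : atoms_sym mu (fine (mu (line e))) (fine (mu (line (perp e)))) 0 0
      e (perp e) e (perp e).
    apply: H => //.
    - by split=> //; exact: measurable_line.
    - by split=> // z.
    - exact: negligible_off_frame.
  have h1 := mass _ _ _ _ _ _ _ _ e H; have h2 := mass _ _ _ _ _ _ _ _ (perp e) H.
  rewrite ip_perp ip_perpl Ee Ep in h1 h2.
  (* A single frame is repeated, the second copy with weight 0. *)
  exists e, e, 2^-1%R, 0%R; split; first by rewrite addr0.
  have w1 : fine (mu (line e)) = 2^-1%R by lra.
  have w2 : fine (mu (line (perp e))) = 2^-1%R by lra.
  by rewrite w1 w2 in H.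
have [ab1 ab2] : ip a b != 0%R /\ ip (perp a) b != 0%R.
  by apply/andP; rewrite -negb_or -mulf_eq0.
have Ea : ip a a = 1%R := Sa; have Eb : ip b b = 1%R := Sb.
have Ea' : ip (perp a) (perp a) = 1%R := S1_perp _ Sa.
have Eb' : ip (perp b) (perp b) = 1%R := S1_perp _ Sb.
have pp : ip (perp a) (perp b) = ip a b by rewrite /ip /perp /=; ring.
have ap : ip a (perp b) = (- ip (perp a) b)%R by rewrite /ip /perp /=; ring.
have H : atoms_sym mu (fine (mu (line a))) (fine (mu (line (perp a))))
    (fine (mu (line b))) (fine (mu (line (perp b)))) a (perp a) b (perp b).
  apply: atoms_sym_of_cover => //.
  - by split; exact: measurable_line.
  - by split.
  - split.
    + by rewrite setIC; apply: (line_disjoint a); rewrite ?ip_perp ?Ea ?oner_neq0.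
    + rewrite setIUl (line_disjoint (perp a)) ?ip_perpl// set0U.
      by rewrite (line_disjoint a) ?ip_perp.
    + rewrite 2!setIUl (line_disjoint (perp a)) ?ip_perpl ?pp// set0U.
      rewrite (line_disjoint a) ?ip_perp ?ap ?oppr_eq0// set0U.
      by rewrite setIC; apply: (line_disjoint b); rewrite ?ip_perp ?Eb ?oner_neq0.
  - apply: negligibleS (measure_S1_supp mu) => z [Sz nz]; split=> // /cover.
    exact: nz.
have h1 := mass _ _ _ _ _ _ _ _ a H; have h2 := mass _ _ _ _ _ _ _ _ (perp a) H.
have h3 := mass _ _ _ _ _ _ _ _ b H; have h4 := mass _ _ _ _ _ _ _ _ (perp b) H.
have h5 := ip_frame a b b.
rewrite !(ipC b) !(ipC (perp b)) ?ip_perp ?ip_perpl ?Ea ?Eb ?Ea' ?Eb' ?pp ?ap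
  in h1 h2 h3 h4 h5.
move: H h1 h2 h3 h4 h5 ab1 ab2.
set w1 := fine _; set w2 := fine _; set w3 := fine _; set w4 := fine _.
set c := ip a b; set s := ip (perp a) b => H h1 h2 h3 h4 h5 c0 s0.
have s2 : (s ^+ 2 = 1 - c ^+ 2)%R by lra.
have s20 : (1 - c ^+ 2 != 0)%R by rewrite -s2 sqrf_eq0.
have c20 : (c ^+ 2 != 0)%R by rewrite sqrf_eq0.
rewrite sqrrN s2 in h1 h2 h3 h4; set k := (c ^+ 2)%R in h1 h2 h3 h4 s20 c20.
(* Differences of the mass equations within each frame, where c^2 - s^2 = 2 k - 1. Eliminating w1 -
   w2 leaves 4 k (1 - k) (w3 - w4) = 0, and both k and 1 - k are nonzero because the frames share no
   line. *)
have d1 : (w1 - w2 = - (w3 - w4) * (2 * k - 1))%R by lra.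
have d2 : ((w1 - w2) * (2 * k - 1) + (w3 - w4) = 0)%R by lra.
have w34 : w3 = w4.
  apply/eqP; rewrite -subr_eq0; apply/eqP.
  apply: (mulfI (mulf_neq0 c20 s20)); rewrite mulr0.
  by rewrite d1 in d2; lra.
have w12 : w1 = w2 by rewrite w34 in d1; lra.
exists a, b, w2, w4; split; first by rewrite w34 w12 in h1 h2; lra.
by rewrite w12 w34 in H.
Qed.

Theorem theorem4p5 (R : realType) (mu : probability (R * R)%type R)
    (hS1 : mu S1 = 1) :
  let T := \int[mu]_(x in S1) \int[mu]_(y in S1) \int[mu]_(z in S1)
             (`| ip x y * ip x z * ip y z |)%:E in
  (1 / 4)%:E <= T /\
  (T = (1 / 4)%:E <->
   exists (a b : R * R) (l : R),
     S1 a /\ S1 b /\ (0 <= l <= 1)%R /\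
     forall A : set (R * R), measurable A -> sym_sub_S1 A ->
       mu A = (l / 2)%:E * (\d_a A + \d_(perp a) A)
            + ((1 - l) / 2)%:E * (\d_b A + \d_(perp b) A)).
Proof.
move=> T; split; first exact: abs_energy_ge.
have distr (r : R) (v : R * R) A :
    r%:E * (\d_v A + \d_(perp v) A) = r%:E * \d_v A + r%:E * \d_(perp v) A.
  by rewrite ge0_muleDr.
split=> [E|[a [b [l [Sa [Sb [/andP[l0 l1] muA]]]]]]].
  have [a [b [w [u [wu [[w0 _ u0 _] [[Sa _ Sb _] muA]]]]]]] :=
    frames_of_abs_energy mu hS1 E.
  (* Each line of the first frame has mass lambda/2, so lambda is [2 * w]; then [u] is (1 -
     lambda)/2. *)
  exists a, b, (2 * w)%R; do 3 split=> //; first by apply/andP; split; lra.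
  move=> A mA sA; rewrite !distr muA//.
  rewrite (_ : 2 * w / 2 = w)%R; last by field.
  by rewrite (_ : (1 - 2 * w) / 2 = u)%R ?addeA//; lra.
apply: (@atoms_sym_energy _ mu hS1 a b (l / 2) ((1 - l) / 2)); first by field.
split; first by split; lra.
split; first by split=> //; exact: S1_perp.
by move=> A mA sA; rewrite muA// !distr addeA.
Qed.
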